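(* Let $X$ be a uniformly perfect metric space with more than one point, let $\Phi,\Phi_1$ be admissible functions, let $F\subseteq X$ be non-empty and totally bounded with $0<\dim_{\mathrm A}F<\infty$, let $\eta\in(0,\dim_{\mathrm A}F)$ and let $b>0$. Put $\alpha:=\frac{\dim_{\mathrm A}F}{\dim_{\mathrm A}F-\eta}$ and consider the inequality $$(\ast)\qquad \Phi_1(\delta)\le\left(\Phi(\delta^{1/\alpha})\right)^b.$$ If $(\ast)$ holds for all sufficiently small $\delta>0$, then: if $\underline{\dim}^\Phi F=0$ then $\underline{\dim}^{\Phi_1}F\le\eta$, and if $\overline{\dim}^\Phi F=0$ then $\overline{\dim}^{\Phi_1}F\le\eta$. If we assume only that $(\ast)$ holds along some sequence of $\delta\to0^+$, then: if $\overline{\dim}^\Phi F=0$ then $\underline{\dim}^{\Phi_1}F\le\eta$.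
   Context: For a subset $U$ of a metric space, $|U|$ denotes its diameter, and $B(x,r)$ is the open ball. Convention: $\inf\varnothing=\infty$. A metric space $X$ is uniformly perfect if there is $c\in(0,1)$ such that $B(x,R)\setminus B(x,cR)\neq\varnothing$ for all $x\in X$ and $0<R<|X|$. $N_\delta(F)$ is the smallest number of open balls of radius $\delta/2$ with centres in $F$ needed to cover $F$; $F$ is totally bounded if $N_\delta(F)<\infty$ for all $\delta>0$. A function $\Phi\colon(0,\Delta)\to\mathbb{R}$ (for some $\Delta>0$) is admissible if it is monotonic, $0<\Phi(\delta)\le\delta$ for all $\delta\in(0,\Delta)$, and $\Phi(\delta)/\delta\to0$ as $\delta\to0^+$. For a non-empty totally bounded $F\subseteq X$ and admissible $\Phi$, the upper $\Phi$-intermediate dimension $\overline{\dim}^\Phi F$ is the infimum of all $s\ge0$ such that for all $\epsilon>0$ there exists $\delta_0\in(0,1]$ (with $(0,\delta_0)$ contained in the domain of $\Phi$) such that for all $\delta\in(0,\delta_0)$ there is a finite or countable cover $\{U_1,U_2,\dots\}$ of $F$ by subsets of $X$ with $\Phi(\delta)\le|U_i|\le\delta$ for all $i$ and $\sum_i|U_i|^s\le\epsilon$. The lower $\Phi$-intermediate dimension $\underline{\dim}^\Phi F$ is the infimum of all $s\ge0$ such that for all $\epsilon>0$ and $\delta_0\in(0,1]$ there exist $\delta\in(0,\delta_0)$ (in the domain of $\Phi$) and such a cover of $F$ with $\Phi(\delta)\le|U_i|\le\delta$ for all $i$ and $\sum_i|U_i|^s\le\epsilon$. The Assouad dimension $\dim_{\mathrm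 A}F$ is the infimum of all $a$ for which there exists $C>0$ such that $N_r(B(x,R)\cap F)\le C(R/r)^a$ for all $x\in F$ and $0<r<R$. *)

(* Defs.v *)
From mathcomp Require Export all_boot all_order all_algebra finmap.
From mathcomp Require Export all_classical all_reals all_analysis.

Set Implicit Arguments.
Unset Strict Implicit.
Unset Printing Implicit Defensive.

Export Order.TTheory GRing.Theory Num.Theory.
Export numFieldNormedType.Exports.

Local Open Scope classical_set_scope.
Local Open Scope ring_scope.

Section metric_notions.
Context {R : realType} {X : metricType R}.
Implicit Types (F U : set X).

(* The supremum of the empty set is -oo, hence the maximum with 0, which gives
   the empty set diameter 0. *)
Definition diam U : \bar R :=
  maxe 0%E (ereal_sup [set (mdist x y)%:E | x in U & y in U]).

Definition covering_number (d : R) F : \bar R :=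
  ereal_inf [set (#|` C|%:R)%:E | C in [set C : {fset X} |
    [set` C] `<=` F /\ F `<=` \bigcup_(x in [set` C]) ball x (d / 2)]].

Definition totally_bounded F : Prop :=
  forall d : R, 0 < d -> (covering_number d F < +oo)%E.

Definition assouad_dim F : \bar R :=
  ereal_inf [set a%:E | a in [set a : R |
    exists2 C : R, 0 < C & forall (x : X) (r S : R), F x -> 0 < r -> r < S ->
      (covering_number r (ball x S `&` F) <= (C * (S / r) `^ a)%:E)%E]].

End metric_notions.

Definition uniformly_perfect (R : realType) (X : metricType R) : Prop :=
  exists c : R, [/\ 0 < c, c < 1 &
    forall (x : X) (S : R), 0 < S -> (S%:E < diam [set: X])%E ->
      ball x S `\` ball x (c * S) !=set0].

(* A function (0, Delta) -> R is encoded as a total function Phi : R -> R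
   together with Delta; admissibility and the dimensions below do not depend on
   the values of Phi outside ]0, Delta[. *)
Definition admissible (R : realType) (Delta : R) (Phi : R -> R) : Prop :=
  [/\ 0 < Delta,
      {in `]0, Delta[ &, {homo Phi : x y / x <= y}} \/
        {in `]0, Delta[ &, {homo Phi : x y /~ x <= y}},
      {in `]0, Delta[, forall d, 0 < Phi d <= d} &
      Phi d / d @[d --> 0^'+] --> (0 : R)].

Section intermediate_dimensions.
Context {R : realType} {X : metricType R}.
Variables (Delta : R) (Phi : R -> R) (F : set X).

(* Finite and countable covers alike are families indexed by a subset J of nat. *)
Definition has_Phi_cover (s eps d : R) : Prop :=
  exists (J : set nat) (U : nat -> set X),
    [/\ F `<=` \bigcup_(i in J) U i,
        forall i, J i -> ((Phi d)%:E <= diam (U i) <= d%:E)%E &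
        (\esum_(i in J) (diam (U i) `^ s) <= eps%:E)%E].

Definition upper_intermediate_dim : \bar R :=
  ereal_inf [set s%:E | s in [set s : R | 0 <= s /\
    forall eps, 0 < eps ->
      exists d0, [/\ 0 < d0, d0 <= 1, d0 <= Delta &
        forall d, 0 < d -> d < d0 -> has_Phi_cover s eps d]]].

Definition lower_intermediate_dim : \bar R :=
  ereal_inf [set s%:E | s in [set s : R | 0 <= s /\
    forall eps d0, 0 < eps -> 0 < d0 -> d0 <= 1 ->
      exists d, [/\ 0 < d, d < d0, d < Delta & has_Phi_cover s eps d]]].

End intermediate_dimensions.

(* Main.v *)
(* Write A for dim_A F, so that alpha = A / (A - eta), and let eta < s < A. Given
   a cover of F with diameters in [Phi(d'), d'], where d' = d ^ (1 / alpha), each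
   set of diameter t is replaced by balls of diameter about r := t ^ alpha <= d.
   For an exponent a slightly larger than A this takes at most about (t / r) ^ a
   balls, and their cost (t / r) ^ a * r ^ s = t ^ (a - alpha * (a - s)) is at
   most t ^ p for some p > 0, because at a = A the exponent
   A - alpha * (A - s) = A * (s - eta) / (A - eta) is positive. Since F has
   Phi-dimension 0, the sum of the t ^ p can be made arbitrarily small. *)
Require Import Defs.
From mathcomp Require Import lra.

Set Implicit Arguments.
Unset Strict Implicit.
Unset Printing Implicit Defensive.

Local Open Scope classical_set_scope.
Local Open Scope ring_scope.

(** * Sums of non-negative extended reals *)

Lemma esum_pZl_le (R : realType) (T : choiceType) (J : set T) (D : R)
    (f : T -> \bar R) : 0 <= D -> (forall i, (0 <= f i)%E) ->
  (\esum_(i in J) (D%:E * f i) <= D%:E * \esum_(i in J) f i)%E.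
Proof.
move=> D0 f0; apply: ge_ereal_sup => _ [A AJ <-].
rewrite -ge0_mule_fsumr// lee_wpmul2l//.
by apply: esum_ge; exists A.
Qed.

Lemma esum_ord_le (R : realType) (n : nat) (B : R) (f : nat -> \bar R) :
  (forall i, (i < n)%N -> (0 <= f i <= B%:E)%E) ->
  (\esum_(i in `I_n) f i <= (n%:R * B)%:E)%E.
Proof.
move=> fB; rewrite esum_fset//; last first.
  by move=> i; rewrite inE/= => /fB/andP[].
rewrite -fsbig_ord (@le_trans _ _ (\sum_(i < n) B%:E)%E)//.
  by apply: lee_sum => i _; have /andP[] := fB _ (ltn_ord i).
by rewrite sumEFin sumr_const card_ord mulr_natl.
Qed.

(** * Diameters of balls in a uniformly perfect space *)

Section diameter.
Context {R : realType} {X : metricType R}.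
Implicit Types (U : set X) (x y : X).

Lemma diam_ge0 U : (0 <= diam U)%E.
Proof. by rewrite /diam le_max lexx. Qed.

Lemma mdist_le_diam U x y : U x -> U y -> ((mdist x y)%:E <= diam U)%E.
Proof.
move=> Ux Uy; rewrite /diam le_max; apply/orP; right.
by apply: ereal_sup_ubound; exists x => //; exists y.
Qed.

Lemma diam_ball_le x (rho : R) : 0 <= rho -> (diam (ball x rho) <= (2 * rho)%:E)%E.
Proof.
move=> rho0; rewrite /diam ge_max lee_fin mulr_ge0//=.
apply: ge_ereal_sup => _ [y + [z + <-]]; rewrite !ballEmdist/= lee_fin => xy xz.
rewrite (le_trans (metric_triangle y x z))// mulr2n mulrDl mul1r lerD//.
  by rewrite metric_sym ltW.
exact: ltW.
Qed.

(** A point of B(x, rho) outside B(x, c rho) has distance at least c rho from the centre. The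
    distance of two distinct points serves as [tau], since it is at most the diameter of the
    space. *)
Lemma uniformly_perfect_diam_ball :
  uniformly_perfect X -> (exists x y : X, x <> y) ->
  exists c tau : R, [/\ 0 < c, 0 < tau & forall x rho, 0 < rho -> rho < tau ->
    ((c * rho)%:E <= diam (ball x rho))%E].
Proof.
move=> [c [c0 c1 Xc]] [u [v /eqP uv]].
exists c, (mdist u v); split => //; first by rewrite mdist_gt0.
move=> x rho rho0 rhouv.
have /(Xc x _ rho0)[y []] : (rho%:E < diam [set: X])%E.
  by apply: (@lt_le_trans _ _ (mdist u v)%:E); [|exact: mdist_le_diam].
move=> xy; rewrite {1}ballEmdist/= => /negP; rewrite -leNgt => crho.
apply: (@le_trans _ _ (mdist x y)%:E); first by rewrite lee_fin.
by apply: mdist_le_diam => //; exact: ballxx.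
Qed.

End diameter.

(** * Refinement of covers and its cost *)

Section covers.
Context {R : realType} {X : metricType R}.
Variables (F : set X).

(** All diameters lie in (0, 1], so no term grows when the exponent does. *)
Lemma has_Phi_cover_le (Phi : R -> R) (s p eps d : R) : 0 <= s -> s <= p ->
  0 < Phi d -> d <= 1 ->
  has_Phi_cover Phi F s eps d -> has_Phi_cover Phi F p eps d.
Proof.
move=> s0 sp Phi0 d1 [J [U [FU JU sumU]]]; exists J, U; split => //.
apply: le_trans sumU; apply: le_esum => i /JU /andP[].
case: (diam (U i)) => [t| |]; rewrite ?lee_fin// => Phit td.
apply: ger_powR => //.
by rewrite (lt_le_trans Phi0 Phit) (le_trans td).
Qed.

(** The pieces of all the sets [U i] form one family over pairs, whose sum is the iterated sum. *)
Lemma has_Phi_cover_refine (Phi Phi1 : R -> R) (s p eps d d1 D : R) : 0 < D ->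
  (forall V : set X, ((Phi d)%:E <= diam V <= d%:E)%E ->
    exists n (W : nat -> set X), [/\ F `&` V `<=` \bigcup_(j in `I_n) W j,
      forall j, (j < n)%N -> ((Phi1 d1)%:E <= diam (W j) <= d1%:E)%E &
      (\esum_(j in `I_n) (diam (W j) `^ s) <= D%:E * diam V `^ p)%E]) ->
  has_Phi_cover Phi F p eps d -> has_Phi_cover Phi1 F s (D * eps) d1.
Proof.
move=> D0 HV [J [U [FU JU sumU]]].
have /choice[nW HW] : forall i, exists nW : nat * (nat -> set X), J i ->
    [/\ F `&` U i `<=` \bigcup_(j in `I_nW.1) nW.2 j,
      forall j, (j < nW.1)%N -> ((Phi1 d1)%:E <= diam (nW.2 j) <= d1%:E)%E &
      (\esum_(j in `I_nW.1) (diam (nW.2 j) `^ s) <= D%:E * diam (U i) `^ p)%E].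
  move=> i; have [Ji|nJi] := pselect (J i); last by exists (0%N, fun=> set0).
  by have [n [W ?]] := HV _ (JU _ Ji); exists (n, W).
pose K := J `*`` (fun i => `I_(nW i).1).
pose V (k : nat * nat) := (nW k.1).2 k.2.
(* Covers are indexed by subsets of nat, so pairs are coded by [choice.pickle]; no index in use
   reaches the default [set0]. *)
pose W (m : nat) := if choice.unpickle m is Some k then V k else set0.
exists (choice.pickle @` K), W; split.
- move=> x Fx; have [i Ji Ux] := FU _ Fx.
  have [/(_ x (conj Fx Ux))[j jn Wx] _ _] := HW _ Ji.
  by exists (choice.pickle (i, j)); [exists (i, j)|rewrite /W choice.pickleK].
- move=> _ [[i j] [/= Ji jn] <-]; rewrite /W choice.pickleK.
  by have [_ + _] := HW _ Ji; exact.
- rewrite esum_image; last by move=> ? ? _ _; exact: (pcan_inj choice.pickleK).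
  rewrite (eq_esum (b := fun k => (diam (V k) `^ s)%E)); last first.
    by move=> k _; rewrite /W choice.pickleK.
  rewrite -(@esum_esum _ _ _ J (fun i => `I_(nW i).1)
    (fun i j => (diam ((nW i).2 j) `^ s)%E)); last by move=> *; exact: poweR_ge0.
  apply: (@le_trans _ _ (\esum_(i in J) (D%:E * diam (U i) `^ p))%E).
    by apply: le_esum => i Ji; have [] := HW _ Ji.
  apply: le_trans (esum_pZl_le _ (ltW D0) _) _.
    by move=> i; exact: poweR_ge0.
  by rewrite EFinM lee_wpmul2l// lee_fin ltW.
Qed.

(** Doubling [B] makes the bound on the infimum strict, so that some cover realises it. *)
Lemma covering_number_exists (r B : R) (G : set X) :
  (covering_number r G <= B%:E)%E -> 0 < B ->
  exists C : {fset X}, G `<=` \bigcup_(x in [set` C]) ball x (r / 2) /\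
    #|` C|%:R <= 2 * B.
Proof.
move=> GB B0; have : (covering_number r G < (2 * B)%:E)%E.
  by apply: le_lt_trans GB _; rewrite lte_fin mulr_natl mulr2n ltrDl.
move=> /ereal_inf_lt[_ [C [_ GC] <-]]; rewrite lte_fin => /ltW.
by exists C.
Qed.

End covers.

(** If t <= r, the quotient is 1 and r^s <= K^s t^(m s). If r < t, the left side is t^a r^(-(a -
    s)), at most t^(a - alpha (a - s)) because r >= t^alpha. The constant adds up the two cases. *)
Lemma powR_cost_le (R : realType) (t r a s p alpha m K : R) :
  0 < t <= 1 -> 0 < s -> s < a -> 0 < K -> 0 < r ->
  t `^ alpha <= r -> r <= K * t `^ m -> p <= m * s -> p <= a - alpha * (a - s) ->
  (Num.max t r / r) `^ a * r `^ s <= (1 + K `^ s) * t `^ p.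
Proof.
move=> /andP[t0 t1] s0 sa K0 r0 tr rK pms pa.
have t01 : 0 < t <= 1 by rewrite t0.
rewrite mulrDl mul1r; have [tler|rt] := leP t r.
  rewrite divff ?gt_eqF// powR1 mul1r ler_wpDl ?powR_ge0//.
  apply: (@le_trans _ _ ((K * t `^ m) `^ s)).
    by apply: ge0_ler_powR; rewrite ?nnegrE ?mulr_ge0 ?powR_ge0// ltW.
  rewrite powRM ?powR_ge0 ?(ltW K0)// -powRrM ler_pM2l ?powR_gt0//.
  exact: ger_powR.
rewrite ler_wpDr ?mulr_ge0 ?powR_ge0//.
rewrite powRM ?invr_ge0 ?(ltW t0) ?(ltW r0)// -powR_inv1 ?(ltW r0)//.
rewrite -powRrM -mulrA -powRD ?(gt_eqF r0) ?implybT// mulN1r.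
have -> : - a + s = - (a - s) by rewrite opprB addrC.
apply: (@le_trans _ _ (t `^ a * t `^ (- (alpha * (a - s))))).
  rewrite ler_wpM2l ?powR_ge0// !powRN powRrM lef_pV2 ?posrE ?powR_gt0//.
  by apply: ge0_ler_powR; rewrite ?nnegrE ?powR_ge0 ?subr_ge0 ?(ltW sa) ?(ltW r0).
rewrite -powRD ?(gt_eqF t0) ?implybT//; exact: ger_powR.
Qed.

(** * Covering one set by balls of a given size *)

Section refinement.
Context {R : realType} {X : metricType R}.
Variables (F : set X).

Lemma ball_cover_diam_le (c tau a C s lo hi t r : R) (V : set X) :
  (forall (x : X) rho, 0 < rho -> rho < tau ->
    ((c * rho)%:E <= diam (ball x rho))%E) ->
  (forall (x : X) (r S : R), F x -> 0 < r -> r < S ->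
    (covering_number r (ball x S `&` F) <= (C * (S / r) `^ a)%:E)%E) ->
  0 < C -> 0 <= s -> 0 < t -> diam V = t%:E ->
  0 < r -> r / 2 < tau -> lo <= c * (r / 2) -> r <= hi ->
  exists n (W : nat -> set X), [/\ F `&` V `<=` \bigcup_(j in `I_n) W j,
    forall j, (j < n)%N -> (lo%:E <= diam (W j) <= hi%:E)%E &
    (\esum_(j in `I_n) (diam (W j) `^ s) <=
       (2 * C * 2 `^ a * ((Num.max t r / r) `^ a * r `^ s))%:E)%E].
Proof.
move=> Xc FC C0 s0 t0 Vt r0 rtau lor rhi.
have [->|/set0P[x [Fx Vx]]] := eqVneq (F `&` V) set0.
  exists 0%N, (fun=> set0); split => //.
  rewrite II0 esum_set0 lee_fin !mulr_ge0 ?powR_ge0//; exact: ltW.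
(* As [S] exceeds [t], the ball around [x] contains [V]; as it exceeds [r], the Assouad bound
   applies. The factor 2 yields the constant 2^a. *)
pose S := 2 * Num.max t r.
have rS : r < S.
  by rewrite /S mulr_natl mulr2n ltr_pwDl ?lt_max ?t0 ?le_max ?lexx ?orbT.
have tS : t < S.
  by rewrite /S mulr_natl mulr2n ltr_pwDl ?lt_max ?t0 ?le_max ?lexx ?orbT.
have [|N [NF Ncard]] := covering_number_exists (FC x r S Fx r0 rS).
  by rewrite mulr_gt0// powR_gt0// divr_gt0// (lt_trans r0).
have r20 : 0 < r / 2 by rewrite divr_gt0.
have diamW (y : X) : (lo%:E <= diam (ball y (r / 2)) <= r%:E)%E.
  apply/andP; split.
    by apply: le_trans _ (Xc y _ r20 rtau); rewrite lee_fin.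
  by rewrite (le_trans (diam_ball_le _ (ltW r20)))// lee_fin mulrC divfK.
exists #|` N|, (fun j => ball (nth x N j) (r / 2)); split.
- move=> y [Fy Vy]; have [|z zN yz] := NF y.
    split => //; rewrite ballEmdist/=; apply: le_lt_trans tS.
    by rewrite -lee_fin -Vt; exact: mdist_le_diam.
  by exists (index z N); rewrite /= ?index_mem// nth_index.
- by move=> j _; have /andP[-> /le_trans->//] := diamW (nth x N j).
- apply: le_trans (esum_ord_le (B := r `^ s) _) _.
    move=> j _; rewrite poweR_ge0/=.
    have /andP[_] := diamW (nth x N j); move: (diam_ge0 (ball (nth x N j) (r / 2))).
    case: diam => [u| |]; rewrite ?lee_fin// => u0 ur.
    by apply: ge0_ler_powR; rewrite ?nnegrE// ltW.
  rewrite lee_fin mulrA ler_wpM2r ?powR_ge0// (le_trans Ncard)//.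
  rewrite /S -!mulrA powRM// ?divr_ge0 ?le_max ?ltW ?t0//.
Qed.

End refinement.

(** * Transfer of covers from [Phi] to [Phi1] *)

Section transfer.
Context {R : realType} {X : metricType R}.
Variables (F : set X).

(* A set U of diameter t in the given cover is replaced by balls of radius r / 2
   with r := max (t ^ alpha, 2 Phi1(d) / c): the second term makes the diameters
   of the balls at least Phi1(d), and by the comparison of Phi1 with Phi it is at
   most a constant times t ^ b. *)
Lemma has_Phi_cover_transfer (Delta Delta1 : R) (Phi Phi1 : R -> R)
    (a C s alpha b : R) :
  uniformly_perfect X -> (exists x y : X, x <> y) ->
  admissible Delta Phi -> admissible Delta1 Phi1 -> 0 < C ->
  (forall (x : X) (r S : R), F x -> 0 < r -> r < S ->
    (covering_number r (ball x S `&` F) <= (C * (S / r) `^ a)%:E)%E) ->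
  0 < s -> s < a -> 0 < alpha -> 0 < b -> 0 < a - alpha * (a - s) ->
  exists p D tau, [/\ 0 < p, 0 < D, 0 < tau & forall d eps, 0 < d -> d < tau ->
    0 < d `^ alpha^-1 < Delta -> Phi1 d <= Phi (d `^ alpha^-1) `^ b ->
    has_Phi_cover Phi F p eps (d `^ alpha^-1) ->
    has_Phi_cover Phi1 F s (D * eps) d].
Proof.
move=> Xp X1 [_ _ Phi_pos _] [_ _ _ Phi1_cvg] C0 FC s0 sa alpha0 b0 as0.
have [c [tau [c0 tau0 Xc]]] := uniformly_perfect_diam_ball Xp X1.
(* Since Phi1(d)/d tends to 0, balls large enough for the lower bound Phi1(d) still have diameter at
   most d. *)
have [tau1 tau10 Phi1_le] : exists2 tau1, 0 < tau1 &
    forall d, 0 < d -> d < tau1 -> 2 / c * Phi1 d <= d.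
  have c20 : 0 < c / 2 by rewrite divr_gt0.
  have /cvgrPdist_lt/(_ _ c20)[e/= e0 He] := Phi1_cvg.
  exists e => // d d0 de; have := He d; rewrite /= !sub0r !normrN.
  rewrite gtr0_norm// => /(_ de d0) /ltW /(le_trans (ler_norm _)).
  rewrite ler_pdivrMr// mulrAC ler_pdivlMr// => H.
  by rewrite mulrAC ler_pdivrMr// mulrC (mulrC d).
(* For t <= 1 both t^alpha and t^b are at most t^m, whence r <= K t^m below. *)
pose m := Num.min alpha b; pose K := 1 + 2 / c.
have c2_gt0 : 0 < 2 / c by rewrite divr_gt0.
have K0 : 0 < K by rewrite addr_gt0.
have m0 : 0 < m by rewrite lt_min alpha0.
(* The two exponents serve the cases t <= r and r < t of the cost estimate. The bound 1 on [d]
   forces t <= 1. *)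
exists (Num.min (m * s) (a - alpha * (a - s))), (2 * C * 2 `^ a * (1 + K `^ s)),
  (Num.min (Num.min tau tau1) 1); split.
- by rewrite lt_min mulr_gt0.
- by rewrite !mulr_gt0 ?powR_gt0// addr_gt0// powR_gt0.
- by rewrite !lt_min tau0 tau10 ltr01.
move=> d eps d0; rewrite !lt_min -andbA => /and3P[dtau dtau1 d1] dDelta Phi1b.
apply: has_Phi_cover_refine.
  by rewrite !mulr_gt0 ?powR_gt0// addr_gt0// powR_gt0.
move=> V /andP[]; case Vt : (diam V) => [t| |]; rewrite ?lee_fin// => Phit td.
have /andP[Phi0 _] := Phi_pos _ dDelta.
have t0 : 0 < t := lt_le_trans Phi0 Phit.
have t1 : t <= 1.
  by rewrite (le_trans td)// -(powRr0 d) ger_powR ?d0 ?invr_ge0 ?(ltW d1) ?(ltW alpha0).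
have t01 : 0 < t <= 1 by rewrite t0.
pose r := Num.max (t `^ alpha) (2 / c * Phi1 d).
have tar : t `^ alpha <= r by rewrite /r le_max lexx.
have r0 : 0 < r by rewrite (lt_le_trans _ tar)// powR_gt0.
have rd : r <= d.
  rewrite ge_max Phi1_le// andbT.
  rewrite -(powRr1 (ltW d0)) -(mulVf (lt0r_neq0 alpha0)).
  by rewrite powRrM ge0_ler_powR ?nnegrE ?powR_ge0 // ltW.
have rK : r <= K * t `^ m.
  rewrite /K mulrDl mul1r ge_max; apply/andP; split.
    rewrite ler_wpDr ?(mulr_ge0 (ltW c2_gt0)) ?powR_ge0//.
    by apply: ger_powR => //; rewrite ge_min lexx.
  rewrite ler_wpDl ?powR_ge0// ler_pM2l// (le_trans Phi1b)//.
  apply: (@le_trans _ _ (t `^ b)).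
    by rewrite ge0_ler_powR ?nnegrE ?(ltW b0) ?(ltW Phi0) ?(ltW t0).
  by apply: ger_powR => //; rewrite ge_min lexx orbT.
have [||n [W [VW Wd sumW]]] :=
  @ball_cover_diam_le _ _ F c tau a C s (Phi1 d) d t r V Xc FC C0 (ltW s0) t0 Vt r0 _ _ rd.
- by rewrite (le_lt_trans _ dtau)// (le_trans _ rd)// ler_pdivrMr// ler_peMr ?ltW// ltr1n.
- rewrite mulrA mulrAC -ler_pdivrMl ?divr_gt0// invf_div.
  by rewrite le_max lexx orbT.
exists n, W; split=> //; apply: le_trans sumW _.
rewrite poweR_EFin -EFinM lee_fin -[leRHS]mulrA ler_pM2l ?mulr_gt0 ?powR_gt0//.
by apply: (@powR_cost_le _ _ _ _ _ _ alpha m) => //; rewrite ge_min lexx ?orbT.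
Qed.

End transfer.

(** * Covers and exponents extracted from the dimensions *)

Section dimensions.
Context {R : realType} {X : metricType R}.
Variables (Delta : R) (Phi : R -> R) (F : set X).

(** Dimension 0 provides some exponent below [p]; monotonicity in the exponent then gives [p]
    itself. *)
Lemma upper_intermediate_dim_eq0 : admissible Delta Phi ->
  upper_intermediate_dim Delta Phi F = 0%E ->
  forall p eps, 0 < p -> 0 < eps -> exists2 d0, 0 < d0 &
    forall d, 0 < d -> d < d0 -> has_Phi_cover Phi F p eps d.
Proof.
move=> [_ _ Phi_pos _] dim0 p eps p0 eps0.
have : (upper_intermediate_dim Delta Phi F < p%:E)%E by rewrite dim0 lte_fin.
move=> /ereal_inf_lt[_ [s [s0 Hs] <-]]; rewrite lte_fin => /ltW sp.
have [d0 [d00 d01 d0Delta Hd]] := Hs _ eps0.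
exists d0 => // d dgt0 dd0; apply: has_Phi_cover_le (Hd d dgt0 dd0) => //.
  by have [|] := andP (Phi_pos d _); rewrite ?in_itv/= ?dgt0 ?(lt_le_trans dd0).
by rewrite ltW// (lt_le_trans dd0).
Qed.

Lemma lower_intermediate_dim_eq0 : admissible Delta Phi ->
  lower_intermediate_dim Delta Phi F = 0%E ->
  forall p eps d0, 0 < p -> 0 < eps -> 0 < d0 ->
    exists d, [/\ 0 < d, d < d0 & has_Phi_cover Phi F p eps d].
Proof.
move=> [_ _ Phi_pos _] dim0 p eps d0 p0 eps0 d00.
have : (lower_intermediate_dim Delta Phi F < p%:E)%E by rewrite dim0 lte_fin.
move=> /ereal_inf_lt[_ [s [s0 Hs] <-]]; rewrite lte_fin => /ltW sp.
(* Scales below 1 are requested because monotonicity in the exponent needs d <= 1. *)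
have [||d [dgt0 + dDelta Hd]] := Hs _ (Num.min d0 1) eps0.
- by rewrite lt_min d00 ltr01.
- by rewrite ge_min lexx orbT.
rewrite lt_min => /andP[dd0 d1]; exists d; split => //.
apply: has_Phi_cover_le Hd => //; last exact: ltW.
by have [|] := andP (Phi_pos d _); rewrite ?in_itv/= ?dgt0.
Qed.

(** The infimum may not be attained, so the covering bound is used with an exponent [a] slightly
    above it. *)
Lemma assouad_dim_lt (t : R) : (assouad_dim F < t%:E)%E ->
  exists a C : R, [/\ (assouad_dim F <= a%:E)%E, a < t, 0 < C &
    forall (x : X) (r S : R), F x -> 0 < r -> r < S ->
      (covering_number r (ball x S `&` F) <= (C * (S / r) `^ a)%:E)%E].
Proof.
move=> /ereal_inf_lt[_ [a [C C0 HC] <-]]; rewrite lte_fin => at_.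
exists a, C; split => //.
by apply: ereal_inf_lbound; exists a => //; exists C.
Qed.

End dimensions.

(** This reduces the dimension bounds to exponents s with eta < s < dim_A F. *)
Lemma ereal_inf_le_right (R : realType) (S : set R) (x y : R) : x < y ->
  (forall s, x < s -> s < y -> S s) ->
  (ereal_inf [set s%:E | s in S] <= x%:E)%E.
Proof.
move=> xy HS; apply/lee_addgt0Pr => e e0; apply: ge_ereal_inf.
pose z := Num.min (x + e) ((x + y) / 2).
have zxy : z <= (x + y) / 2 by rewrite ge_min lexx orbT.
exists z%:E; last by rewrite -EFinD lee_fin ge_min lexx.
exists z => //; apply: HS; last by apply: (le_lt_trans zxy); lra.
by rewrite lt_min; apply/andP; split; lra.
Qed.

(** * Bounds for the [Phi1]-intermediate dimensions *)

Theorem proposition3p6 (R : realType) (X : metricType R)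
  (X_perfect : uniformly_perfect X) (X_gt1 : exists x y : X, x <> y)
  (Delta Delta1 : R) (Phi Phi1 : R -> R)
  (Phi_adm : admissible Delta Phi) (Phi1_adm : admissible Delta1 Phi1)
  (F : set X) (F_neq0 : F !=set0) (F_tb : totally_bounded F)
  (dimF_gt0 : (0 < assouad_dim F)%E) (dimF_fin : (assouad_dim F < +oo)%E)
  (eta : R) (eta_gt0 : 0 < eta) (eta_lt : (eta%:E < assouad_dim F)%E)
  (b : R) (b_gt0 : 0 < b) :
  let dimF := fine (assouad_dim F) in
  let alpha := dimF / (dimF - eta) in
  (* both sides of the inequality are defined at d, and it holds there *)
  let star := fun d : R =>
    [/\ 0 < d < Delta1, 0 < d `^ alpha^-1 < Delta &
        Phi1 d <= (Phi (d `^ alpha^-1)) `^ b] in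
  ((\forall d \near 0^'+, star d) ->
    (lower_intermediate_dim Delta Phi F = 0%E ->
      (lower_intermediate_dim Delta1 Phi1 F <= eta%:E)%E) /\
    (upper_intermediate_dim Delta Phi F = 0%E ->
      (upper_intermediate_dim Delta1 Phi1 F <= eta%:E)%E)) /\
  ((exists2 u : nat -> R, u @ \oo --> (0 : R) & forall n, star (u n)) ->
    upper_intermediate_dim Delta Phi F = 0%E ->
      (lower_intermediate_dim Delta1 Phi1 F <= eta%:E)%E).
Proof.
move=> dimF alpha star.
have dimFE : assouad_dim F = dimF%:E by rewrite fineK// gt0_fin_numE.
have eta_dimF : eta < dimF by rewrite -lte_fin -dimFE.
have dimF0 : 0 < dimF by rewrite (lt_trans eta_gt0).
have deta : 0 < dimF - eta by rewrite subr_gt0.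
have alpha0 : 0 < alpha by rewrite divr_gt0.
have alphaV0 : 0 < alpha^-1 by rewrite invr_gt0.
have transfer s : eta < s -> s < dimF -> exists p D tau,
    [/\ 0 < p, 0 < D, 0 < tau & forall d eps, star d -> d < tau ->
      has_Phi_cover Phi F p eps (d `^ alpha^-1) ->
      has_Phi_cover Phi1 F s (D * eps) d].
  move=> eta_s s_dimF; have s0 : 0 < s by rewrite (lt_trans eta_gt0).
  (* With alpha = dimF / (dimF - eta), the condition a - alpha (a - s) > 0 amounts to a < dimF s /
     eta, and this threshold exceeds dimF because s > eta. *)
  have [|a [C [dimFa a_lt C0 FC]]] := @assouad_dim_lt _ _ F (dimF * s / eta).
    by rewrite dimFE lte_fin ltr_pdivlMr// ltr_pM2l.
  have {}dimFa : dimF <= a by rewrite -lee_fin -dimFE.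
  have as0 : 0 < a - alpha * (a - s).
    rewrite subr_gt0 /alpha mulrAC ltr_pdivrMr//.
    by move: a_lt; rewrite ltr_pdivlMr//; lra.
  have sa : s < a by exact: lt_le_trans dimFa.
  have [p [D [tau [p0 D0 tau0 H]]]] := has_Phi_cover_transfer X_perfect X_gt1
    Phi_adm Phi1_adm C0 FC s0 sa alpha0 b_gt0 as0.
  by exists p, D, tau; split=> // d eps [/andP[d0 _] dDelta Phi1b] dtau; exact: H.
have powRK d : 0 <= d -> (d `^ alpha) `^ alpha^-1 = d.
  by move=> d0; rewrite -powRrM divff ?gt_eqF// powRr1.
have powRKV d : 0 <= d -> (d `^ alpha^-1) `^ alpha = d.
  by move=> d0; rewrite -powRrM mulVf ?gt_eqF// powRr1.
have powR_lt d t : 0 < d -> 0 < t -> d < t `^ alpha^-1 -> d `^ alpha < t.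
  move=> d0 t0 dt; rewrite -[ltRHS](powRKV _ (ltW t0)).
  by rewrite gt0_ltr_powR// nnegrE ?powR_ge0// ltW.
have powRV_lt d t : 0 < d -> 0 < t -> d < t `^ alpha -> d `^ alpha^-1 < t.
  move=> d0 t0 dt; rewrite -[ltRHS](powRK _ (ltW t0)).
  by rewrite gt0_ltr_powR// nnegrE ?powR_ge0// ltW.
have [Delta1_gt0 _ _ _] := Phi1_adm.
split=> [[e /= e0 star_e]|[u u0 star_u] dim0].
  have {}star_e d : 0 < d -> d < e -> star d.
    by move=> d0 de; apply: star_e => //=; rewrite sub0r normrN gtr0_norm.
  split=> dim0; apply: ereal_inf_le_right eta_dimF _ => s eta_s s_dimF;
    (split; first by rewrite ltW// (lt_trans eta_gt0));
    have [p [D [tau [p0 D0 tau0 H]]]] := transfer s eta_s s_dimF.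
    move=> eps d0 eps0 d00 d01.
    (* A good scale d for [Phi] is sought below t^(1/alpha), so that d^alpha < t is the scale for
       [Phi1]. Covers of sum eps / D absorb the factor [D]. *)
    pose t := Num.min (Num.min d0 tau) e.
    have t0 : 0 < t by rewrite !lt_min d00 tau0.
    have [d [dgt0 dt Hd]] := lower_intermediate_dim_eq0 Phi_adm dim0 p0
      (divr_gt0 eps0 D0) (powR_gt0 alpha^-1 t0).
    have := powR_lt _ _ dgt0 t0 dt; rewrite !lt_min -andbA => /and3P[dd0 dtau de].
    have star_d := star_e _ (powR_gt0 _ dgt0) de.
    exists (d `^ alpha); split => //.
    - exact: powR_gt0.
    - by have [/andP[]] := star_d.
    - have -> : eps = D * (eps / D) by rewrite mulrC divfK// gt_eqF.
      by apply: H star_d dtau _; rewrite powRK ?(ltW dgt0).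
  move=> eps eps0.
  have [d0 d00 Hd] := upper_intermediate_dim_eq0 Phi_adm dim0 p0 (divr_gt0 eps0 D0).
  (* The term d0^alpha puts d^(1/alpha) below [d0]; [tau] and [e] serve the transfer and the
     inequality. *)
  exists (Num.min (Num.min (Num.min (Num.min (d0 `^ alpha) tau) e) 1) Delta1).
  split; rewrite ?ge_min ?lexx ?orbT// ?lt_min ?powR_gt0 ?tau0 ?e0 ?ltr01//.
  move=> d dgt0; rewrite !lt_min -!andbA => /and5P[dd0 dtau de _ _].
  have -> : eps = D * (eps / D) by rewrite mulrC divfK// gt_eqF.
  by apply: H (star_e _ dgt0 de) dtau _; apply: Hd; [exact: powR_gt0|exact: powRV_lt].
apply: ereal_inf_le_right eta_dimF _ => s eta_s s_dimF.
split; first by rewrite ltW// (lt_trans eta_gt0).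
have [p [D [tau [p0 D0 tau0 H]]]] := transfer s eta_s s_dimF.
move=> eps d0 eps0 d00 d01.
have [d1 d10 Hd] := upper_intermediate_dim_eq0 Phi_adm dim0 p0 (divr_gt0 eps0 D0).
(* Covers for [Phi] exist at every scale below [d1], hence at u_n^(1/alpha) as soon as u_n <
   d1^alpha; one such n suffices for the lower dimension. *)
pose t := Num.min (Num.min d0 tau) (d1 `^ alpha).
have t0 : 0 < t by rewrite !lt_min d00 tau0 powR_gt0.
have /cvgrPdist_lt/(_ _ t0)[n _ /(_ n (leqnn n))] := u0.
have [/andP[un0 unDelta1] _ _] := star_u n.
rewrite /= sub0r normrN gtr0_norm// !lt_min -andbA => /and3P[und0 untau und1].
exists (u n); split => //.
have -> : eps = D * (eps / D) by rewrite mulrC divfK// gt_eqF.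
by apply: H (star_u n) untau _; apply: Hd; [exact: powR_gt0|exact: powRV_lt].
Qed.
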